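(* Let $\Xi\subset\mathbb{R}^N$ be a compact convex set with non-empty interior, let $P\in\mathbb{R}^{n_0\times N}$ have full row rank, and let $\Omega$ be a pole-set of $P\Xi$ such that $|\Omega| = 1+\dim(P\Xi)$. Then the optimal solution of the multipolar robust counterpart MRC associated with $(\Xi,P,\Omega)$ is exactly the best solution whose recourse is affine in $P\xi$. That is: a pair $(u,v(\cdot))$ is an optimal pair of MRC if and only if it is an optimal pair of the problem of minimizing $c^Tu$ over all $u\in\mathbb{R}^n$ and all policies of the form $v(\xi)=w+WP\xi$ ($w\in\mathbb{R}^q$, $W\in\mathbb{R}^{q\times n_0}$) such that $U_\xi u+V v(\xi)\le b_\xi$ for all $\xi\in\Xi$; and the two problems have the same optimal value.
   Context: Setting: $m,n,q\ge 1$ are integers, $V\in\mathbb{R}^{m\times q}$ and $c\in\mathbb{R}^n$ are fixed. An uncertain parameter is $\xi\equiv[U_\xi,b_\xi]$ with $U_\xi\in\mathbb{R}^{m\times n}$, $b_\xi\in\mathbb{R}^m$, identified with a vector of $\mathbb{R}^N$, $N=m(n+1)$. Vector inequalities are componentwise. Write $P\Xi=\{P\xi:\xi\in\Xi\}\subset\mathbb{R}^{n_0}$. A pole-set of $P\Xi$ is a finite set $\Omega\subset\mathbb{R}^{n_0}$ with $P\Xi\subseteq\operatorname{conv}\Omega$. For $\xi\in\Xi$ let $$\Lambda_\xi=\Big\{\lambda\in\mathbb{R}^{\Omega}:\ \sum_{\omega\in\Omega}\lambda_\omega\,\omega=P\xi,\ \sum_{\omega\in\Omega}\lambda_\omega=1,\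 \lambda_\omega\ge 0\ \forall \omega\Big\}.$$ The multipolar robust counterpart MRC is the problem of minimizing $c^Tu$ over $u\in\mathbb{R}^n$ and recourse vectors $v_\omega\in\mathbb{R}^q$ ($\omega\in\Omega$) subject to $$U_\xi u+V\sum_{\omega\in\Omega}\lambda_\omega v_\omega\le b_\xi\qquad\text{for all }\xi\in\Xi\text{ and all }\lambda\in\Lambda_\xi .$$ Optimal values are infima in $[-\infty,+\infty]$. Call $(u,v(\cdot))$, with $v:\Xi\to\mathbb{R}^q$, an optimal pair of MRC if there is an optimal solution $(u,(v_\omega)_{\omega\in\Omega})$ of MRC with $v(\xi)=\sum_{\omega}\lambda_\omega v_\omega$ for all $\xi\in\Xi$ and all $\lambda\in\Lambda_\xi$. An optimal pair of the affine problem is a feasible pair (first-stage vector and affine policy on $\Xi$) attaining its optimal value. *)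

(* Defs.v *)
From HB Require Import structures.
From mathcomp Require Import all_boot all_order all_algebra.
From mathcomp Require Import finmap.
From mathcomp Require Import all_classical all_reals all_analysis.
Import numFieldNormedType.Exports.

Set Implicit Arguments.
Unset Strict Implicit.
Unset Printing Implicit Defensive.

Import Order.TTheory GRing.Theory Num.Theory.

Local Open Scope classical_set_scope.
Local Open Scope ring_scope.

Definition conv_hull (R : realType) (E : lmodType R) (A : set E) : set E :=
  smallest (@convex_set R E) A.

Definition affine_set (R : realType) (E : lmodType R) (A : set E) : Prop :=
  forall (x y : E) (t : R), A x -> A y -> A ((1 - t) *: x + t *: y).

Definition affine_hull (R : realType) (E : lmodType R) (A : set E) : set E :=
  smallest (@affine_set R E) A.

(* The dimension of A is that of the direction space L of its affine hull
   x + L; the default value 0 is only taken when A is empty. *)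
Definition affine_dim (R : realType) (E : vectType R) (A : set E) : nat :=
  xget 0%N [set d | exists (x : E) (L : {vspace E}),
    affine_hull A = [set x + l | l in [set l | l \in L]] /\ \dim L = d].

Definition opt_value (R : realType) (X : Type) (S : set X) (f : X -> R) :
    \bar R :=
  ereal_inf [set (f x)%:E | x in S].

Definition opt_sol (R : realType) (X : Type) (S : set X) (f : X -> R) : set X :=
  [set x | S x /\ (f x)%:E = opt_value S f].

Definition cv_le (R : realType) (m : nat) (a b : 'cV[R]_m) : Prop :=
  forall i, a i ord0 <= b i ord0.

(* A vector of R^(m(n+1)) lists, row by row, the entries of the m x (n+1)
   matrix [U, b]. *)
Definition Upart (R : realType) (m n : nat) (xi : 'cV[R]_(m * (n + 1))) :
    'M[R]_(m, n) :=
  lsubmx (vec_mx xi^T).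

Definition bpart (R : realType) (m n : nat) (xi : 'cV[R]_(m * (n + 1))) :
    'cV[R]_m :=
  rsubmx (vec_mx xi^T).

Definition cost (R : realType) (n : nat) (c u : 'cV[R]_n) : R :=
  (c^T *m u) ord0 ord0.

Definition pimage (R : realType) (N n0 : nat) (P : 'M[R]_(n0, N))
    (Xi : set 'cV[R]_N) : set 'cV[R]_n0 :=
  [set P *m xi | xi in Xi].

Definition pole_set (R : realType) (n0 : nat) (A : set 'cV[R]_n0)
    (Omega : {fset 'cV[R]_n0}) : Prop :=
  A `<=` conv_hull [set` Omega].

Definition Lambda (R : realType) (n0 : nat) (Omega : {fset 'cV[R]_n0})
    (x : 'cV[R]_n0) : set (Omega -> R) :=
  [set lambda | [/\ \sum_(w : Omega) lambda w *: val w = x,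
                    \sum_(w : Omega) lambda w = 1 &
                    forall w, 0 <= lambda w]].

Section Problems.
Variables (R : realType) (m n q n0 : nat).
Variables (V : 'M[R]_(m, q)) (c : 'cV[R]_n).
Variables (Xi : set 'cV[R]_(m * (n + 1))) (P : 'M[R]_(n0, m * (n + 1))).

Definition mrc_feasible (Omega : {fset 'cV[R]_n0}) :
    set ('cV[R]_n * (Omega -> 'cV[R]_q)) :=
  [set z | forall xi lambda, Xi xi -> Lambda (P *m xi) lambda ->
     cv_le (Upart xi *m z.1 + V *m (\sum_(w : Omega) lambda w *: z.2 w))
           (bpart xi)].

Definition mrc_value (Omega : {fset 'cV[R]_n0}) : \bar R :=
  opt_value (mrc_feasible (Omega := Omega)) (fun z => cost c z.1).

Definition mrc_opt_pair (Omega : {fset 'cV[R]_n0}) (u : 'cV[R]_n)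
    (v : Xi -> 'cV[R]_q) : Prop :=
  exists vw : Omega -> 'cV[R]_q,
    opt_sol (mrc_feasible (Omega := Omega)) (fun z => cost c z.1) (u, vw) /\
    forall (xi : Xi) lambda, Lambda (P *m val xi) lambda ->
      v xi = \sum_(w : Omega) lambda w *: vw w.

Definition affine_feasible : set ('cV[R]_n * (Xi -> 'cV[R]_q)) :=
  [set z | (exists (w : 'cV[R]_q) (W : 'M[R]_(q, n0)),
              forall xi, z.2 xi = w + W *m (P *m val xi)) /\
           forall xi, cv_le (Upart (val xi) *m z.1 + V *m z.2 xi)
                            (bpart (val xi))].

Definition affine_value : \bar R :=
  opt_value affine_feasible (fun z => cost c z.1).

Definition affine_opt_pair (u : 'cV[R]_n) (v : Xi -> 'cV[R]_q) : Prop :=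
  opt_sol affine_feasible (fun z => cost c z.1) (u, v).

End Problems.

(* Main.v *)
(* Since Xi has an interior point and P is onto, P Xi affinely spans R^n0, so
   Omega consists of n0 + 1 points whose affine hull is R^n0: the poles are
   affinely independent.  Hence every choice of values at the poles is
   interpolated by exactly one affine map, and for such values the recourse
   sum_w lambda_w v_w equals this map at P xi, whatever lambda in Lambda_xi.
   Thus feasible points of both problems correspond, with the same cost. *)

Require Import Defs.
From HB Require Import structures.
From mathcomp Require Import all_boot all_order all_algebra.
From mathcomp Require Import finmap.
From mathcomp Require Import all_classical all_reals all_analysis.
Import numFieldNormedType.Exports.
Import Order.TTheory GRing.Theory Num.Theory.
Local Open Scope classical_set_scope.
Local Open Scope ring_scope.

(** Since [P] is onto, [y - P *m x0] lifts to a direction [z]; a short step from the interior point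
    [x0] along [z] stays in [Xi], and [y] lies on the line through the images of its two ends. *)
Lemma affine_hull_pimage (R : realType) (N n0 : nat) (P : 'M[R]_(n0, N))
    (Xi : set 'cV[R]_N) :
  interior Xi !=set0 -> row_free P -> affine_hull (pimage P Xi) = setT.
Proof.
move=> [x0 x0Xi] Pfree; apply/seteqP; split => // y _ A [Aaff PXiA] /=.
pose z := pinvmx P *m (y - P *m x0).
have Pz : P *m z = y - P *m x0 by rewrite mulmxA mulmxVp// mul1mx.
have cvg0 : x0 + t *: z @[t --> (0 : R)^'+] --> x0.
  rewrite -[X in _ --> X]addr0 -(scale0r z).
  apply: cvgD; first exact: cvg_cst.
  by apply: cvgZr_tmp; exact: cvg_at_right_filter.
have [t t_gt0 Xit] : exists2 t : R, 0 < t & Xi (x0 + t *: z).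
  have nXi : \forall t \near (0 : R)^'+, Xi (x0 + t *: z) by exact: cvg0.
  near (0 : R)^'+ => t; exists t => //; near: t; exact: nXi.
(* The factor [t^-1] undoes the shrinking of the step; it usually exceeds 1, which affine but not
   convex combinations allow. *)
have -> : y = (1 - t^-1) *: (P *m x0) + t^-1 *: (P *m (x0 + t *: z)).
  rewrite mulmxDr -scalemxAr Pz scalerDr scalerA mulVf ?gt_eqF// scale1r.
  by rewrite addrA -scalerDl subrK scale1r addrC subrK.
apply: Aaff; apply: PXiA; last by exists (x0 + t *: z).
by exists x0 => //; exact: interior_subset.
Unshelve. all: by end_near. Qed.

Lemma dim_fullv_cV (R : realType) (n : nat) :
  \dim (fullv : {vspace 'cV[R]_n}) = n.
Proof. by rewrite dimvf dim_matrix; exact: muln1. Qed.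

Lemma affine_dim_setT (R : realType) (n0 : nat) (A : set 'cV[R]_n0) :
  affine_hull A = setT -> affine_dim A = n0.
Proof.
move=> hullA; apply: xget_unique.
  exists 0, fullv; split; last exact: dim_fullv_cV.
  apply: (etrans hullA); apply/seteqP; split => // x _.
  by exists x; rewrite /= ?memvf ?add0r.
move=> d [x [L [hullL <-]]].
suff -> : L = fullv by exact: dim_fullv_cV.
apply/vspaceP => l; rewrite memvf.
have : [set x + l | l in [set l | l \in L]] (x + l) by rewrite -hullL hullA.
by move=> -[l' /= l'L /addrI <-].
Qed.

Lemma affine_convex_set (R : realType) (E : lmodType R) (A : set E) :
  affine_set A -> @convex_set R E A.
Proof.
move=> Aaff x y t /set_mem Ax /set_mem Ay; apply/mem_set.
(* [convex_set] puts the weight [t] on [x], whereas [affine_set] puts it on [y]. *)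
have := Aaff x y (1 - t%:num) Ax Ay.
by rewrite subKr.
Qed.

(** The points that admit barycentric weights form a convex set (mix the weights) containing each
    pole (take an indicator), hence the whole hull. *)
Lemma conv_hull_Lambda (R : realType) (n0 : nat) (Omega : {fset 'cV[R]_n0})
    (x : 'cV[R]_n0) :
  conv_hull [set` Omega] x -> Lambda (Omega := Omega) x !=set0.
Proof.
move: x; apply: smallest_sub => [x y t|w wOmega].
  move=> /set_mem[a [<- a1 a_ge0]] /set_mem[b [<- b1 b_ge0]].
  apply/mem_set; exists (fun w => t%:num * a w + (1 - t%:num) * b w); split.
  - under eq_bigr do rewrite scalerDl -!scalerA.
    by rewrite big_split -!scaler_sumr.
  - by rewrite big_split -!mulr_sumr a1 b1 !mulr1 /= addrC subrK.
  - by move=> w; rewrite addr_ge0// mulr_ge0.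
pose w0 : Omega := [` wOmega]%fset.
exists (fun w' => (w' == w0)%:R); split => [||w'].
- rewrite (bigD1 w0)//= eqxx scale1r big1 ?addr0// => w' /negPf ->.
  by rewrite scale0r.
- by rewrite (bigD1 w0)//= eqxx big1 ?addr0// => w' /negPf ->.
- exact: ler0n.
Qed.

Section AffinelyIndependentPoles.
Variables (R : realType) (n0 : nat) (Omega : {fset 'cV[R]_n0}).

(* Linear independence of these rows is affine independence of Omega. *)
Let homog : 'M[R]_(#|{: Omega}|, n0 + 1) :=
  \matrix_(i < #|{: Omega}|) row_mx (val (enum_val i))^T 1%:M.

(** A kernel vector [k] holds the coefficients of an affine function vanishing on [Omega]. Its zero
    set [H] is affine, so it contains the convex hull of [Omega], then [A], then the whole space. *)
Lemma row_free_homog (A : set 'cV[R]_n0) :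
  affine_hull A = setT -> A `<=` conv_hull [set` Omega] ->
  row_free homog^T.
Proof.
move=> hullA AOmega; apply: inj_row_free => k kM0.
pose H : set 'cV[R]_n0 := [set x | row_mx x^T 1%:M *m k^T = 0].
have Haff : affine_set H.
  move=> x y t; rewrite /H/= => Hx Hy.
  have -> : row_mx ((1 - t) *: x + t *: y)^T 1%:M
      = (1 - t) *: row_mx x^T 1%:M + t *: row_mx y^T (1%:M : 'M[R]_1).
    rewrite !scale_row_mx add_row_mx -scalerDl subrK scale1r.
    by rewrite !linearD !linearZ.
  by rewrite mulmxDl -!scalemxAl Hx Hy !scaler0 addr0.
have HT x : H x.
  have : affine_hull A x by rewrite hullA.
  apply: smallest_sub => //; apply: subset_trans AOmega _.
  apply: smallest_sub => [|w wOmega]; first exact: affine_convex_set.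
  have /(congr1 trmx) := kM0; rewrite trmx_mul trmxK trmx0.
  move=> /(congr1 (row (enum_rank [` wOmega]%fset))).
  by rewrite row_mul rowK enum_rankK row0.
apply: trmx_inj; rewrite trmx0 -[k^T]vsubmxK.
have Hk x : x^T *m usubmx k^T + dsubmx k^T = 0.
  by have := HT x; rewrite /H/= -{1}[k^T]vsubmxK mul_row_col mul1mx.
(* The value at 0 gives the constant term; the values at the unit vectors give the linear
   coefficients. *)
have kd0 : dsubmx k^T = 0.
  by have := Hk 0; rewrite trmx0 mul0mx add0r.
have -> : usubmx k^T = 0.
  apply/row_matrixP => i.
  by have := Hk (delta_mx 0 i)^T; rewrite kd0 addr0 trmxK -rowE row0.
by rewrite kd0 col_mx0.
Qed.

Lemma affine_interpolation (A : set 'cV[R]_n0) (q : nat)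
    (v : Omega -> 'cV[R]_q) :
  affine_hull A = setT -> A `<=` conv_hull [set` Omega] ->
  #|` Omega| = (1 + n0)%N ->
  exists (b : 'cV[R]_q) (W : 'M[R]_(q, n0)), forall w, v w = b + W *m val w.
Proof.
move=> hullA AOmega cardOmega.
(* The rank is [n0 + 1] because the columns are independent; the cardinality of [Omega] makes this
   the number of rows too. *)
have homog_free : row_free homog.
  have /eqP := row_free_homog _ hullA AOmega.
  by rewrite /row_free mxrank_tr => ->; rewrite -cardfE cardOmega addnC.
pose K := pinvmx homog *m \matrix_(i < #|{: Omega}|) (v (enum_val i))^T.
have homogK : homog *m K = \matrix_(i < #|{: Omega}|) (v (enum_val i))^T.
  by rewrite mulmxA mulmxVp// mul1mx.
(* The last row of [K] multiplies the coordinate 1 appended to each pole, so it is the constant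
   term. *)
exists (dsubmx K)^T, (usubmx K)^T => w.
have := congr1 (row (enum_rank w)) homogK.
rewrite row_mul !rowK enum_rankK -{1}[K]vsubmxK mul_row_col mul1mx.
by move=> /(congr1 trmx); rewrite trmxK linearD/= trmx_mul trmxK addrC.
Qed.

End AffinelyIndependentPoles.

Lemma Lambda_affine (R : realType) (n0 q : nat) (Omega : {fset 'cV[R]_n0})
    (x : 'cV[R]_n0) (lambda : Omega -> R) (b : 'cV[R]_q)
    (W : 'M[R]_(q, n0)) :
  Lambda x lambda ->
  \sum_(w : Omega) lambda w *: (b + W *m val w) = b + W *m x.
Proof.
move=> [<- lambda1 _]; under eq_bigr do rewrite scalerDr.
rewrite big_split -scaler_suml lambda1 scale1r mulmx_sumr; congr (_ + _).
by apply: eq_bigr => w _; rewrite scalemxAr.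
Qed.
Arguments Lambda_affine {R n0 q Omega x lambda b W}.

Theorem theorem1 (R : realType) (m n q n0 : nat)
    (m_gt0 : (0 < m)%N) (n_gt0 : (0 < n)%N) (q_gt0 : (0 < q)%N)
    (V : 'M[R]_(m, q)) (c : 'cV[R]_n)
    (Xi : set 'cV[R]_(m * (n + 1))) (P : 'M[R]_(n0, m * (n + 1)))
    (Omega : {fset 'cV[R]_n0})
    (Xi_compact : compact Xi)
    (Xi_convex : @convex_set R 'cV[R]_(m * (n + 1)) Xi)
    (Xi_interior : interior Xi !=set0)
    (P_full_row_rank : row_free P)
    (Omega_poles : pole_set (pimage P Xi) Omega)
    (Omega_card : (#|` Omega| = 1 + affine_dim (pimage P Xi))%N) :
  (forall (u : 'cV[R]_n) (v : Xi -> 'cV[R]_q),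
      mrc_opt_pair V c P Omega u v <-> affine_opt_pair V c P u v) /\
  mrc_value V c Xi P Omega = affine_value V c Xi P.
Proof.
have hullPXi := affine_hull_pimage _ _ _ _ _ Xi_interior P_full_row_rank.
rewrite (affine_dim_setT _ _ _ hullPXi) in Omega_card.
have interp (vw : Omega -> 'cV[R]_q) :=
  affine_interpolation _ _ _ _ _ vw hullPXi Omega_poles Omega_card.
(* Without some [lambda] at [xi], the MRC constraint there would be vacuous and [v xi] would be left
   undetermined. *)
have Lambda_neq0 (xi : Xi) : Lambda (Omega := Omega) (P *m val xi) !=set0.
  apply: conv_hull_Lambda; apply: Omega_poles.
  by exists (val xi) => //; exact: set_valP.
pose pol b W (xi : Xi) : 'cV[R]_q := b + W *m (P *m val xi).
pose poles b W (w : Omega) : 'cV[R]_q := b + W *m val w.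
have feasE u b W : mrc_feasible V Xi P (u, poles b W) <->
    affine_feasible V P (u, pol b W).
  split=> [mrc_fs|[_ aff_fs]].
    split; first by exists b, W.
    move=> xi; have [lambda Llambda] := Lambda_neq0 xi.
    have := mrc_fs (val xi) lambda (set_valP xi) Llambda.
    by rewrite /= (Lambda_affine Llambda).
  move=> xi lambda Xi_xi Llambda; rewrite /= (Lambda_affine Llambda).
  exact: (aff_fs (exist _ xi (mem_set Xi_xi))).
have poles_ex (vw : Omega -> 'cV[R]_q) : exists b W, vw = poles b W.
  by have [b [W vwE]] := interp vw; exists b, W; exact/funext.
have pol_ex u v : affine_feasible V P (u, v) -> exists b W, v = pol b W.
  by move=> [[b [W vE]] _]; exists b, W; exact/funext.
have valueE : mrc_value V c Xi P Omega = affine_value V c Xi P.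
  (* The two infima range over the same set of costs, as [feasE] preserves [u]. *)
  congr ereal_inf; apply/seteqP; split => _ [[u v] /= fs_uv <-].
    have [b [W vE]] := poles_ex v; rewrite vE in fs_uv.
    by exists (u, pol b W) => //; exact/feasE.
  have [b [W vE]] := pol_ex _ _ fs_uv; rewrite vE in fs_uv.
  by exists (u, poles b W) => //; exact/feasE.
split=> // u v; split=> [[vw [[fs_vw opt_vw] vE]]|[fs_v opt_v]].
  have [b [W vwE]] := poles_ex vw; rewrite vwE in fs_vw vE.
  have -> : v = pol b W.
    apply/funext => xi; have [lambda Llambda] := Lambda_neq0 xi.
    by rewrite (vE _ _ Llambda) (Lambda_affine Llambda).
  by split; [exact/feasE | rewrite opt_vw; exact: valueE].
have [b [W vE]] := pol_ex _ _ fs_v; rewrite vE in fs_v.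
exists (poles b W); split.
  by split; [exact/feasE | rewrite opt_v; exact/esym/valueE].
by move=> xi lambda Llambda; rewrite vE (Lambda_affine Llambda).
Qed.
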